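(* Let $l(k)$ denote the largest integer such that every $k$-CNF formula in which every clause intersects at most $l(k)$ other clauses is satisfiable. Then $$\left\lfloor\frac{2^k}e\right\rfloor-1\le l(k)=\left(e^{-1}+O(k^{-1/2})\right)2^k\quad\text{as } k\to\infty.$$
   Context: A $k$-CNF formula is a conjunction of clauses, each clause being a disjunction of exactly $k$ distinct literals (a literal is a Boolean variable or its negation). Two clauses intersect if they share at least one variable (in either negated or non-negated form). *)

(* Defs.v *)
From mathcomp Require Import all_boot all_order all_algebra.
From mathcomp Require Import all_classical all_reals all_analysis.
Set Implicit Arguments.
Unset Strict Implicit.
Unset Printing Implicit Defensive.
Import Order.TTheory GRing.Theory Num.Theory.

Local Open Scope ring_scope.

(* The literal (v, true) is the variable v; (v, false) is its negation. *)
Definition literal (V : finType) : finType := (V * bool)%type.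

Definition clause (V : finType) : finType := {set literal V}.

(* A finite set of clauses, read as their conjunction. *)
Definition formula (V : finType) : finType := {set clause V}.

Definition kCNF (V : finType) (k : nat) (F : formula V) : Prop :=
  forall C : clause V, C \in F -> #|C| = k.

Definition clause_vars (V : finType) (C : clause V) : {set V} :=
  [set x.1 | x in C].

Definition clauses_intersect (V : finType) (C D : clause V) : bool :=
  clause_vars C :&: clause_vars D != finset.set0.

Definition other_neighbours (V : finType) (F : formula V) (C : clause V) :
    {set clause V} :=
  [set D in F | (D != C) && clauses_intersect C D].

Definition satisfies (V : finType) (s : V -> bool) (F : formula V) : Prop :=
  forall C : clause V, C \in F -> exists2 x : literal V, x \in C & s x.1 = x.2.

Definition satisfiable (V : finType) (F : formula V) : Prop :=
  exists s : V -> bool, satisfies s F.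

(* The bound d is an integer, so that the largest admissible bound exists even
   for k = 0, where it is -1: the empty clause is an unsatisfiable formula. *)
Definition forces_sat (k : nat) (d : int) : Prop :=
  forall (V : finType) (F : formula V),
    kCNF k F ->
    (forall C : clause V, C \in F -> #|other_neighbours F C|%:Z <= d) ->
    satisfiable F.

Definition is_largest_forcing (k : nat) (d : int) : Prop :=
  forces_sat k d /\ forall d' : int, forces_sat k d' -> d' <= d.

(* Main.v *)
Require Import Defs.
From mathcomp Require Import all_boot all_order all_algebra.
From mathcomp Require Import all_classical all_reals all_analysis.
Import Order.TTheory GRing.Theory Num.Theory.
Import numFieldNormedType.Exports.
Set Implicit Arguments.
Unset Strict Implicit.
Unset Printing Implicit Defensive.
From mathcomp Require Import ring lra zify.

(* Lower bound: the Lovasz local lemma, proved by counting assignments.  An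
   assignment falsifying a clause [C] is determined outside the variables of
   [C], which replaces the independence of [C] from the clauses disjoint from it.

   Upper bound (following Gebauer, Szabo and Tardos): write [K = k - 1].  A binary
   tree with all leaves at depth at least [k] and at most [d] leaves at distance
   less than [k] below each node other than the root yields an unsatisfiable
   k-CNF: the inner nodes are the variables, and the clause of a leaf consists of
   the last [k] literals on its branch.  A clause meeting it hangs from the other
   child of one of its [k] nodes, so it has at most [k * d] neighbours.

   Such trees with [d] close to [(2 / e) * 2 ^ K / K] are built from the root by
   prescribing how many leaves occur at each distance.  The numbers
   [d / 2 ^ (j + 1)] of leaves at distance [K - j] would be preserved by halving
   everything at each node.  Instead, every [r] levels the leaves which have been
   carried for about [K / r] rounds are concentrated on a few of the [2 ^ r]
   descendants, whose subtrees are then complete; the other descendants share the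
   remaining leaves and so receive a factor [1 + v] more of them.  With
   [N = K / r] rounds this can be sustained with increasing [v] as long as
   [A * (1 + v) ^ N > v] for all [v], where [A = d * r / 2 ^ (K + 1)]; the minimum
   of [(1 + v) ^ N / v] is about [e * N], whence the constant [2 / e].  Taking
   [r ^ 4] close to [K] makes all errors of relative size [r ^ -2 = K ^ (-1/2)]. *)

(** * Formulas from binary trees *)

Section Formulas.
Import mathcomp.boot.finset.
Local Open Scope nat_scope.

(* [x] bounds the number of leaves at each distance [i < k] from the root of a
   binary tree in which every node but the root has at most [d] leaves at
   distance less than [k] below it. *)
Inductive tree_profile (k d : nat) : (nat -> nat) -> Prop :=
| tree_leaf x : 0 < x 0 -> tree_profile k d x
| tree_node x y z : (forall i, i.+1 < k -> y i + z i <= x i.+1) ->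
    \sum_(i < k) y i <= d -> \sum_(i < k) z i <= d ->
    tree_profile k d y -> tree_profile k d z -> tree_profile k d x.

(** Effect of a new root above a subtree: the literal [l] of the new edge enters a clause only while
    that clause has fewer than [k] literals, so each clause keeps the last [k] edges of its
    branch. *)
Definition extend_clause (V V' : finType) (k : nat) (f : V -> V')
    (l : literal V') (C : clause V) : clause V' :=
  [set (f x.1, x.2) | x in C] :|: [set x | (x == l) && (#|C| < k)].

Lemma extend_clauseP (V V' : finType) (k : nat) (f : V -> V')
    (l : literal V') (C : clause V) (y : literal V') :
  reflect ((exists2 x, x \in C & y = (f x.1, x.2)) \/ y = l /\ #|C| < k)
          (y \in extend_clause k f l C).
Proof.
rewrite in_setU inE; apply: (iffP orP) => -[].
- by case/imsetP => x xC ->; left; exists x.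
- by case/andP => /eqP -> ?; right.
- by case=> x xC ->; left; apply: imset_f.
- by case=> -> ->; rewrite eqxx; right.
Qed.

Lemma clause_varsP (V : finType) (C : clause V) (v : V) :
  reflect (exists b, (v, b) \in C) (v \in clause_vars C).
Proof.
apply: (iffP imsetP) => [[[w b] xC ->]|[b vC]]; first by exists b.
by exists (v, b).
Qed.

Lemma clauses_intersectP (V : finType) (C D : clause V) :
  reflect (exists v b c, (v, b) \in C /\ (v, c) \in D) (clauses_intersect C D).
Proof.
apply: (iffP (set0Pn _)) => [[v]|[v [b [c [vC vD]]]]].
  by rewrite inE => /andP[/clause_varsP[b vC] /clause_varsP[c vD]]; exists v, b, c.
exists v; rewrite inE; apply/andP; split; apply/clause_varsP; [exists b|exists c] => //.
Qed.

Section Extend.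
Variables (V V' : finType) (k : nat) (f : V -> V') (l : literal V').
Hypotheses (f_inj : injective f) (fl : forall v, f v != l.1).

Lemma extend_clause_old (C : clause V) v b :
  ((f v, b) \in extend_clause k f l C) = ((v, b) \in C).
Proof.
apply/extend_clauseP/idP => [[[[w c] wC [/f_inj -> ->]]//|[E _]]|vC].
  by have := fl v; rewrite -E eqxx.
by left; exists (v, b).
Qed.

Lemma extend_clause_new (C : clause V) :
  (l \in extend_clause k f l C) = (#|C| < k).
Proof.
apply/extend_clauseP/idP => [[[[w c] wC E]|[_ //]]|]; last by right.
by have := fl w; rewrite E eqxx.
Qed.

Lemma card_extend_clause (C : clause V) :
  #|extend_clause k f l C| = #|C| + (#|C| < k).
Proof.
rewrite /extend_clause cardsU (card_imset _ _); last first.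
  by move=> [v b] [w c] /= [/f_inj -> ->].
have -> : [set x | (x == l) && (#|C| < k)] = if #|C| < k then [set l] else set0.
  by apply/setP => x; case: ifP; rewrite !inE ?andbT ?andbF.
rewrite setIC (_ : _ :&: _ = set0) ?cards0 ?subn0.
  by case: ifP; rewrite ?cards1 ?cards0.
apply/setP => x; rewrite in_set0; apply/negP; rewrite inE => /andP[H /imsetP[[v b] _ E]].
by move: H; case: ifP; rewrite !inE // => _ /eqP El; have := fl v; rewrite -El E eqxx.
Qed.

Lemma extend_clause_intersect (C D : clause V) :
  clauses_intersect (extend_clause k f l C) (extend_clause k f l D) ->
  clauses_intersect C D \/ (#|C| < k /\ #|D| < k).
Proof.
case/clauses_intersectP => v [b [c [/extend_clauseP H1 /extend_clauseP H2]]].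
case: H1 => [[[w1 b1] w1C [E1 _]]|[E1 kC]].
  case: H2 => [[[w2 b2] w2C [E2 _]]|[E2 kC]].
    left; apply/clauses_intersectP; exists w1, b1, b2; split => //.
    by move: E2; rewrite E1 /= => /f_inj ->.
  by have := fl w1; rewrite -E2 /= -E1 eqxx.
case: H2 => [[[w2 b2] w2C [E2 _]]|[_ kD]]; last by right.
by have := fl w2; rewrite -E1 /= -E2 eqxx.
Qed.

Lemma intersect_extend_clause (C D : clause V) :
  clauses_intersect C D ->
  clauses_intersect (extend_clause k f l C) (extend_clause k f l D).
Proof.
case/clauses_intersectP => v [b [c [vC vD]]]; apply/clauses_intersectP.
by exists (f v), b, c; rewrite !extend_clause_old.
Qed.

Lemma extend_satisfies (s : V' -> bool) (F : formula V) :
  s l.1 != l.2 -> satisfies s (extend_clause k f l @: F) ->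
  satisfies (s \o f) F.
Proof.
move=> sl sF C CF; have [|y] := sF (extend_clause k f l C); first exact: imset_f.
case/extend_clauseP => [[x xC ->] sx|[-> _] sl']; first by exists x.
by move: sl; rewrite sl' eqxx.
Qed.

End Extend.

Definition small_clauses (V : finType) (k : nat) (F : formula V) :=
  [set C in F | #|C| < k].

Lemma card_small_clauses (V : finType) (k : nat) (F : formula V) :
  #|small_clauses k F| = \sum_(i < k) #|[set C in F | #|C| == i :> nat]|.
Proof.
rewrite -sum1_card.
transitivity (\sum_(i < k) \sum_(C in [set C in F | #|C| == i :> nat]) 1); last first.
  by apply: eq_bigr => i _; rewrite sum1_card.
rewrite (exchange_big_dep (fun C => C \in small_clauses k F)) /=; last first.
  by move=> i C _; rewrite !inE => /andP[-> /eqP ->] /=.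
apply: eq_bigr => C; rewrite inE => /andP[CF Ck].
rewrite (eq_bigl (pred1 (Ordinal Ck))) ?big_pred1_eq // => i.
by rewrite -[RHS]val_eqE /= [RHS]eq_sym inE CF.
Qed.

Section Join.
Variables (V V1 V2 : finType) (k d : nat) (f1 : V1 -> V) (f2 : V2 -> V).
Variables (l1 l2 : literal V) (F1 : formula V1) (F2 : formula V2).
Hypotheses (f1_inj : injective f1) (f2_inj : injective f2).
Hypotheses (f1l : forall v, f1 v != l1.1) (f2l : forall v, f2 v != l1.1).
Hypotheses (f12 : forall v w, f1 v != f2 w) (l12 : l1.1 = l2.1).

Let e1 := extend_clause k f1 l1.
Let e2 := extend_clause k f2 l2.

Lemma join_intersect (C : clause V1) (D : clause V2) :
  clauses_intersect (e1 C) (e2 D) -> #|C| < k /\ #|D| < k.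
Proof.
case/clauses_intersectP => v [b [c [/extend_clauseP H1 /extend_clauseP H2]]].
case: H1 => [[[w1 b1] w1C [E1 _]]|[E1 kC]].
  case: H2 => [[[w2 b2] w2C [E2 _]]|[E2 _]].
    by have := f12 w1 w2; rewrite -E1 -E2 eqxx.
  by have := f1l w1; rewrite l12 -E2 /= -E1 eqxx.
case: H2 => [[[w2 b2] w2C [E2 _]]|[_ kD]] //.
by have := f2l w2; rewrite -E1 /= -E2 eqxx.
Qed.

(** Call a clause short if it has fewer than [k] literals. Short clauses of [F1] already intersect,
    so the new literal creates no pair inside [F1]. A short [C] gains at most the [d] short clauses
    of [F2] and grows by one literal, which pays for them; a full clause gains nothing. *)
Lemma join_neighbours (C : clause V1) :
  (forall C D, C \in F1 -> D \in F1 -> #|C| < k -> #|D| < k -> C != D ->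
     clauses_intersect C D) ->
  #|small_clauses k F2| <= d -> C \in F1 ->
  #|other_neighbours F1 C| <= #|C| * d ->
  #|other_neighbours (e1 @: F1 :|: e2 @: F2) (e1 C)| <= #|e1 C| * d.
Proof.
move=> F1small F2small CF1 Cd.
rewrite (card_extend_clause k f1_inj f1l) mulnDl.
pose B := if #|C| < k then e2 @: small_clauses k F2 else set0.
have : other_neighbours (e1 @: F1 :|: e2 @: F2) (e1 C) \subset
    e1 @: other_neighbours F1 C :|: B.
  apply/fintype.subsetP => E; rewrite in_set in_setU => /andP[EF /andP[EC CE]].
  case/orP: EF => /imsetP[D DF DE]; subst E; rewrite in_setU; apply/orP; [left|right].
    have DC : D != C by apply: contraNneq EC => ->.
    apply: imset_f; rewrite inE DF DC /=.
    case: (extend_clause_intersect f1_inj f1l CE) => // -[kC kD].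
    by apply: F1small => //; rewrite eq_sym.
  case: (join_intersect CE) => kC kD; rewrite /B kC.
  by apply: imset_f; rewrite inE DF.
move/subset_leq_card/leq_trans; apply; apply: leq_trans (leq_card_setU _ _) _.
apply: leq_add; first exact: leq_trans (leq_imset_card _ _) _.
rewrite /B; case: ifP => _; rewrite ?cards0 // mul1n.
exact: leq_trans (leq_imset_card _ _) _.
Qed.

End Join.

(** A clause with fewer than [k] literals in the join has received the new literal, so it had
    exactly one literal less before. *)
Lemma join_card (V V1 V2 : finType) (k : nat) (f1 : V1 -> V) (f2 : V2 -> V)
    (l1 l2 : literal V) (F1 : formula V1) (F2 : formula V2) (i : nat) :
  injective f1 -> injective f2 ->
  (forall v, f1 v != l1.1) -> (forall v, f2 v != l2.1) -> i.+1 < k ->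
  #|[set C in extend_clause k f1 l1 @: F1 :|: extend_clause k f2 l2 @: F2
      | #|C| == i.+1]| <=
  #|[set C in F1 | #|C| == i]| + #|[set C in F2 | #|C| == i]|.
Proof.
move=> i1 i2 n1 n2 ik.
have size_eq n : n <= k -> n + (n < k) == i.+1 -> n == i.
  by move=> nk; case: (ltnP n k) => /= h; rewrite ?addn1 ?addn0 ?eqSS // => /eqP ?;
     subst; move: ik; rewrite ltnNge h.
have size_eq' n : n + (n < k) == i.+1 -> n == i.
  case: (leqP n k) => [/size_eq//|kn]; rewrite ltnNge (ltnW kn) /= addn0 => /eqP E.
  by move: kn; rewrite E ltnNge (ltnW ik).
apply: leq_trans (leq_add (leq_imset_card (extend_clause k f1 l1) _)
                          (leq_imset_card (extend_clause k f2 l2) _)).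
apply: leq_trans (leq_card_setU _ _).
apply/subset_leq_card/fintype.subsetP => E; rewrite in_set !in_setU => /andP[EF].
case/orP: EF => /imsetP[D DF ->].
- rewrite (card_extend_clause k i1 n1) => /size_eq' /eqP DE.
  by rewrite imset_f // inE DF DE eqxx.
- rewrite (card_extend_clause k i2 n2) => /size_eq' /eqP DE.
  by rewrite (imset_f (extend_clause k f2 l2)) ?orbT // inE DF DE eqxx.
Qed.

(** Induction on the tree; a clause size below [k] is the distance of its leaf from the root. The
    intersection of short clauses is carried along for [join_neighbours]; across a new root it comes
    from the new variable. *)
Lemma tree_profile_formula (k d : nat) (x : nat -> nat) :
  0 < k -> tree_profile k d x ->
  exists (V : finType) (F : formula V),
    [/\ ~ satisfiable F,
        forall C, C \in F -> #|C| <= k,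
        forall C D, C \in F -> D \in F -> #|C| < k -> #|D| < k -> C != D ->
          clauses_intersect C D,
        forall C, C \in F -> #|other_neighbours F C| <= #|C| * d &
        forall i, i < k -> #|[set C in F | #|C| == i]| <= x i].
Proof.
move=> k_gt0; elim=> {x} [x x0|x y z xyz yd zd _ [V1 [F1 [un1 le1 sm1 nb1 ct1]]]
  _ [V2 [F2 [un2 le2 sm2 nb2 ct2]]]].
  (* A leaf gives the single empty clause over no variables. *)
  exists void, [set set0]; split.
  - by case=> s /(_ set0); rewrite inE eqxx => /(_ isT)[l]; rewrite inE.
  - by move=> C; rewrite inE => /eqP ->; rewrite cards0.
  - by move=> C D; rewrite !inE => /eqP -> /eqP ->; rewrite eqxx.
  - move=> C; rewrite inE => /eqP ->; rewrite cards0 mul0n leqn0 cards_eq0.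
    by apply/eqP/setP => D; rewrite !inE; case: eqP.
  - move=> [|i] _.
      apply: leq_trans x0; rewrite -(cards1 (set0 : clause void)).
      by apply/subset_leq_card/fintype.subsetP => C; rewrite !inE => /andP[].
    rewrite (_ : [set C in _ | _] = set0) ?cards0 //; apply/setP => C; rewrite !inE.
    by apply/negP => /andP[/eqP ->]; rewrite cards0.
pose V := option (V1 + V2).
pose f1 (v : V1) : V := Some (inl v); pose f2 (v : V2) : V := Some (inr v).
pose l1 : literal V := (None, true); pose l2 : literal V := (None, false).
have i1 : injective f1 by move=> ? ? [].
have i2 : injective f2 by move=> ? ? [].
have n1 v : f1 v != l1.1 by [].
have n2 v : f2 v != l2.1 by [].
have s1 : #|small_clauses k F1| <= d.
  by rewrite card_small_clauses (leq_trans _ yd) // leq_sum // => i _; apply: ct1.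
have s2 : #|small_clauses k F2| <= d.
  by rewrite card_small_clauses (leq_trans _ zd) // leq_sum // => i _; apply: ct2.
pose e1 := extend_clause k f1 l1; pose e2 := extend_clause k f2 l2.
have small1 (C : clause V1) : #|e1 C| < k -> #|C| < k.
  by rewrite (card_extend_clause k i1 n1); apply: leq_ltn_trans; apply: leq_addr.
have small2 (C : clause V2) : #|e2 C| < k -> #|C| < k.
  by rewrite (card_extend_clause k i2 n2); apply: leq_ltn_trans; apply: leq_addr.
exists V, (e1 @: F1 :|: e2 @: F2); split.
(* The value of the new variable falsifies the literal added on one side, so the subformula of that
   side would be satisfied. *)
- case=> s sF; case E: (s None).
    apply: un2; exists (s \o f2); apply: (@extend_satisfies _ _ k _ l2);
      first by rewrite /= E.
    by move=> C CF; apply: sF; rewrite inE CF orbT.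
  apply: un1; exists (s \o f1); apply: (@extend_satisfies _ _ k _ l1);
    first by rewrite /= E.
  by move=> C CF; apply: sF; rewrite inE CF.
- move=> C; rewrite inE => /orP[] /imsetP[D DF ->].
    rewrite (card_extend_clause k i1 n1); case: ltnP => h; first by rewrite addn1.
    by rewrite addn0 le1.
  rewrite (card_extend_clause k i2 n2); case: ltnP => h; first by rewrite addn1.
  by rewrite addn0 le2.
- move=> C D; rewrite !inE => /orP[] /imsetP[C' C'F ->] /orP[] /imsetP[D' D'F ->].
  + move=> /small1 kC /small1 kD ne; apply: intersect_extend_clause => //.
    by apply: sm1 => //; apply: contraNneq ne => ->.
  + move=> /small1 kC /small2 kD _; apply/clauses_intersectP.
    by exists None, true, false; rewrite -/l1 -/l2 !extend_clause_new.
  + move=> /small2 kC /small1 kD _; apply/clauses_intersectP.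
    by exists None, false, true; rewrite -/l1 -/l2 !extend_clause_new.
  + move=> /small2 kC /small2 kD ne; apply: intersect_extend_clause => //.
    by apply: sm2 => //; apply: contraNneq ne => ->.
- move=> C; rewrite inE => /orP[] /imsetP[D DF ->].
    by apply: join_neighbours => //; apply: nb1.
  by rewrite setUC; apply: join_neighbours => //; apply: nb2.
- move=> [_|i ik].
    rewrite (_ : [set C in _ | _] = set0) ?cards0 //.
    apply/setP => C; rewrite in_set0; apply/negP; rewrite inE in_setU => /andP[].
    have pos n : (n + (n < k) == 0) = false by case: n => [|n]; rewrite ?k_gt0 ?addSn.
    by case/orP => /imsetP[D _ ->]; rewrite (card_extend_clause k) ?pos.
  apply: leq_trans (xyz i ik); apply: leq_trans (join_card _ _ i1 i2 n1 n2 ik) _.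
  by apply: leq_add; [apply: ct1|apply: ct2]; apply: ltnW.
Qed.

(** The zero profile leaves no clause shorter than [k], so the formula of the tree is a genuine
    [k]-CNF. *)
Lemma tree_profile_not_forces_sat (k d : nat) :
  0 < k -> tree_profile k d (fun=> 0) -> ~ forces_sat k (k * d)%:Z.
Proof.
move=> k_gt0 /(tree_profile_formula k_gt0)[V [F [un le _ nb ct]]] /(_ V F) H.
have cF C : C \in F -> #|C| = k.
  move=> CF; have := le C CF; rewrite leq_eqVlt => /orP[/eqP//|kC].
  have := ct _ kC; rewrite leqn0 cards_eq0 => /eqP E.
  by have := in_set0 C; rewrite -E !inE CF eqxx.
apply: un; apply: H => // C CF.
by rewrite lez_nat -{1}(cF C CF); apply: nb.
Qed.

End Formulas.
(** * The local lemma *)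

Section LocalLemma.
Import mathcomp.boot.finset.
Variable (V : finType).
Implicit Types (C D : clause V) (S F : formula V) (s : {ffun V -> bool}).

Definition holds s C := [exists x in C, s x.1 == x.2].

Definition models S : {set {ffun V -> bool}} := [set s | [forall C in S, holds s C]].

Local Open Scope nat_scope.

Lemma modelsP S s : reflect (forall C, C \in S -> holds s C) (s \in models S).
Proof. by rewrite inE; apply: forall_inP. Qed.

Lemma models_sub S S' : S' \subset S -> models S \subset models S'.
Proof.
move=> /fintype.subsetP SS; apply/fintype.subsetP => s /modelsP sS.
by apply/modelsP => C /SS; apply: sS.
Qed.

Definition flip s (U : clause V) : {ffun V -> bool} :=
  [ffun v => if (v, ~~ s v) \in U then ~~ s v else s v].

(* An assignment falsifying [C] is determined by its restriction to the other
   variables, so flipping it on the literals of [U], for all subsets [U] of [C],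
   gives [2 ^ #|C|] distinct assignments. *)
Lemma card_falsify_independent C S :
  (forall D, D \in S -> ~~ clauses_intersect C D) ->
  #|[set s in models S | ~~ holds s C]| * 2 ^ #|C| <= #|models S|.
Proof.
move=> CS; rewrite -card_powerset -cardsX.
pose A := finset.setX [set s in models S | ~~ holds s C] (powerset C).
have AP p : p \in A -> [/\ forall D, D \in S -> holds p.1 D,
    forall v b, (v, b) \in C -> b = ~~ p.1 v & forall l, l \in p.2 -> l \in C].
  rewrite inE => /andP[]; rewrite 2!inE => /andP[/forall_inP pS].
  rewrite negb_exists_in => /forall_inP pC; rewrite inE.
  move=> /fintype.subsetP UC; split=> //.
  by move=> v b /pC /=; case: b (p.1 v) => -[].
rewrite -(@card_in_imset _ _ (fun p => flip p.1 p.2)).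
  apply/subset_leq_card/fintype.subsetP => _ /imsetP[[s U] /AP /= [sS sC UC] ->].
  apply/modelsP => D DS; have /exists_inP[[v b] xD /= svb] := sS D DS.
  apply/exists_inP; exists (v, b) => //=; rewrite ffunE ifF //.
  apply: contraNF (CS D DS) => /UC vC; apply/set0Pn; exists v; rewrite inE.
  by apply/andP; split; apply/imsetP; [exists (v, ~~ s v)|exists (v, b)].
move=> [s U] [t W] /AP /= [_ sC UC] /AP /= [_ tC WC] /ffunP E.
have st : s = t.
  apply/ffunP => v; have := E v; rewrite !ffunE.
  case: ifP => [/UC/tC/(congr1 negb)|_]; first by rewrite !negbK.
  by case: ifP => // /WC/sC/(congr1 negb); rewrite !negbK.
subst t; congr (_, _); apply/setP => -[v b]; apply/idP/idP => H.
  have E' := sC _ _ (UC _ H); subst b; have := E v.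
  by rewrite !ffunE H; case: ifP => // _; case: (s v).
have E' := sC _ _ (WC _ H); subst b; have := E v.
by rewrite !ffunE H; case: ifP => // _; case: (s v).
Qed.

Lemma card_models_setU1 C S :
  #|models (C |: S)| + #|[set s in models S | ~~ holds s C]| = #|models S|.
Proof.
rewrite -(cardsID [set s | holds s C] (models S)); congr (_ + _).
  apply: eq_card => s; rewrite !inE; apply/forall_inP/andP => [H|[/forall_inP H sC] D].
    split; last by apply: H; rewrite !inE eqxx.
    by apply/forall_inP => D DS; apply: H; rewrite !inE DS orbT.
  by rewrite !inE => /orP[/eqP -> //|]; apply: H.
by apply: eq_card => s; rewrite !inE andbC.
Qed.

Local Open Scope ring_scope.
Variables (R : realFieldType) (k d : nat) (q : R) (F : formula V).
Hypotheses (Fk : kCNF k F) (q_gt0 : 0 < q) (q_le1 : q <= 1).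
Hypothesis Fd : forall C, C \in F -> (#|other_neighbours F C| <= d)%N.
Hypothesis qd : 1 <= (1 - q) * q ^+ d * 2 ^+ k.

(** The clauses of [A] outside [B] are added one at a time, each keeping at least a fraction [q] of
    the models. *)
Lemma models_chain (A B : formula V) :
  (forall S C, S \proper A -> C \in A ->
     q * #|models S|%:R <= #|models (C |: S)|%:R) ->
  B \subset A -> q ^+ #|A :\: B| * #|models B|%:R <= #|models A|%:R.
Proof.
move=> step; have [n] := ubnP #|A :\: B|; elim: n B => // n IH B Bn BA.
have [/eqP|[D]] := set_0Vmem (A :\: B).
  rewrite setD_eq0 => AB; have -> : A = B by apply/eqP; rewrite eqEsubset AB.
  by rewrite setDv cards0 expr0 mul1r.
rewrite inE => /andP[DB DA].
have AB1 : #|A :\: B| = #|A :\: (D |: B)|.+1.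
  by rewrite [LHS](cardsD1 D) !inE DB DA add1n setDDl (setUC B).
rewrite AB1 exprSr -mulrA; apply: le_trans (IH (D |: B) _ _).
- rewrite ler_pM2l ?exprn_gt0 //; apply: step => //.
  by rewrite properE BA; apply/fintype.subsetPn; exists D.
- by rewrite -ltnS -AB1.
- by rewrite finset.subUset sub1set DA.
Qed.

(** In probabilistic terms, given [S] the clause [C] holds with probability at least [q]. Strong
    induction on the size of [S]: restoring the neighbours [S1] of [C] to [S2] keeps at least a
    fraction [q ^ d] of the models, while [C] fails on at most a fraction [2 ^ -k] of the models of
    [S2]. *)
Lemma models_setU1 (S : formula V) C : S \subset F -> C \in F ->
  q * #|models S|%:R <= #|models (C |: S)|%:R.
Proof.
have [n] := ubnP #|S|; elim: n S C => // n IH S C Sn SF CF.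
have [CS|CS] := boolP (C \in S).
  by rewrite (finset.setUidPr _) ?sub1set // ler_piMl.
pose S1 := S :&: other_neighbours F C; pose S2 := S :\: other_neighbours F C.
have S12 : S :\: S2 = S1 by rewrite /S2 setDDr setDv set0U.
have chain : q ^+ #|S1| * #|models S2|%:R <= #|models S|%:R.
  rewrite -S12; apply: models_chain; last exact: subsetDl.
  move=> T D TS DS; apply: IH.
  - exact: leq_trans (proper_card TS) _.
  - exact: fintype.subset_trans (proper_sub TS) SF.
  - exact: (fintype.subsetP SF).
have S1d : q ^+ d <= q ^+ #|S1|.
  rewrite ler_wiXn2l // ?ltW //; apply: leq_trans (Fd CF).
  by apply: subset_leq_card; apply: subsetIr.
have bad : #|[set s in models S | ~~ holds s C]|%:R * 2 ^+ k <= #|models S2|%:R :> R.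
  rewrite -natrX -natrM ler_nat -(Fk CF).
  apply: leq_trans (_ : #|[set s in models S2 | ~~ holds s C]| * 2 ^ #|C| <= _)%N.
    rewrite leq_mul2r subset_leq_card ?orbT //; apply/fintype.subsetP => s.
    case/setIdP => sS sC; apply/setIdP; split=> //.
    exact: fintype.subsetP (models_sub (subsetDl S _)) _ sS.
  apply: card_falsify_independent => D; rewrite !inE => /andP[+ DS].
  rewrite (fintype.subsetP SF) //= negb_and negbK => /orP[/eqP DC|//].
  by rewrite -DC DS in CS.
move: chain; rewrite -(card_models_setU1 C S) natrD.
move: bad; set b := #|[set s in models S | _]|%:R; set M := #|models (C |: S)|%:R.
move=> bad chain.
(* [M + b] counts the models of [S]. With [qd] this yields [b <= (1 - q) * (M + b)], which is the
   claim rearranged. *)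
have bS : (q ^+ d * 2 ^+ k) * b <= M + b.
  apply: le_trans chain; rewrite -mulrA [2 ^+ k * b]mulrC.
  by rewrite ler_pM // ?exprn_ge0 ?(ltW q_gt0) // mulr_ge0 ?exprn_ge0 // ler0n.
have : (1 - q) * ((q ^+ d * 2 ^+ k) * b) <= (1 - q) * (M + b).
  by rewrite ler_wpM2l // subr_ge0.
have : b <= (1 - q) * q ^+ d * 2 ^+ k * b by rewrite ler_peMl // ler0n.
rewrite -!mulrA => /le_trans /[apply].
by rewrite mulrBl mul1r lerBrDr addrC lerD2r.
Qed.

Lemma asymmetric_local_lemma : satisfiable F.
Proof.
have : 0 < #|models F|%:R :> R.
  apply: lt_le_trans (models_chain _ (finset.sub0set F)); last first.
    by move=> S C SF CF; apply: models_setU1 => //; apply: proper_sub.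
  rewrite mulr_gt0 ?exprn_gt0 // ltr0n card_gt0; apply/set0Pn.
  by exists [ffun=> true]; apply/modelsP => C; rewrite inE.
rewrite ltr0n card_gt0 => /set0Pn[s /modelsP sF]; exists s => C /sF.
by case/exists_inP => l lC /eqP sl; exists l.
Qed.
End LocalLemma.

Local Open Scope ring_scope.

Lemma expr_le_expR1 (R : realType) (n : nat) : (1 + n%:R^-1) ^+ n <= expR 1 :> R.
Proof.
case: n => [|n]; first by rewrite expr0 -expR0 ler_expR.
apply: (@le_trans _ _ (expR n.+1%:R^-1 ^+ n.+1)).
  by rewrite lerXn2r ?nnegrE ?addr_ge0 ?invr_ge0 ?expR_ge0 // expR_ge1Dx.
by rewrite -expRM_natl mulrV ?unitfE.
Qed.

(** For [q = d / (d + 1)] the product [(1 - q) * q ^ d] is the inverse of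
    [(d + 1) * (1 + 1 / d) ^ d], which is at most [e * (d + 1)]. *)
Lemma local_lemma (R : realType) (k d : nat) (V : finType) (F : formula V) :
  expR 1 * d.+1%:R <= (2 : R) ^+ k -> kCNF k F ->
  (forall C, C \in F -> (#|other_neighbours F C| <= d)%N) -> satisfiable F.
Proof.
move=> ed Fk Fd; case: d ed Fd => [|d] ed Fd.
  (* At [d = 0] the general choice of [q] would be zero; [1 / 2] works as soon as [k] is positive,
     which [e > 1] ensures. *)
  apply: (@asymmetric_local_lemma _ R k 0 2^-1) => //.
  - by rewrite invf_le1 // ler1n.
  - have k0 : (0 < k)%N.
      by case: k ed {Fk} => //; rewrite mulr1 expr0 leNgt expR_gt1 ltr01.
    rewrite expr0 mulr1 -[k]prednK // exprS mulrA (_ : (1 - 2^-1) * 2 = 1) ?mul1r.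
      by rewrite exprn_ege1 // ler1n.
    by field.
have q_eq : 1 - d.+2%:R^-1 = (1 + d.+1%:R^-1)^-1 :> R.
  have : 0 < d.+1%:R :> R by [].
  rewrite -(natr1 d.+1); move: d.+1%:R => x x_gt0.
  by field; rewrite -?natr1 !gt_eqF ?addr_gt0 // ltr_wpDr.
have Q_gt0 : 0 < 1 + d.+1%:R^-1 :> R by rewrite addr_gt0 ?invr_gt0.
apply: (@asymmetric_local_lemma _ R k d.+1 (1 - d.+2%:R^-1)) => //.
- by rewrite q_eq invr_gt0.
- rewrite opprB addrCA subrr addr0 q_eq exprVn -mulrA ler_pdivlMl // mulr1.
  rewrite ler_pdivlMl ?exprn_gt0 //; apply: le_trans ed.
  by rewrite ler_pM2r // expr_le_expR1.
Qed.
(** * Construction of trees by rounds *)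

Section TreeConstruction.
Local Open Scope nat_scope.
Lemma sum_interval n u p :
  \sum_(c < n) (u <= c < u + p : nat) <= p.
Proof.
suff -> : \sum_(c < n) (u <= c < u + p : nat) = minn (n - u) p by exact: geq_minr.
elim: n => [|n IH]; first by rewrite big_ord0 sub0n min0n.
by rewrite big_ord_recr /= IH; lia.
Qed.

Variables (k d : nat).
Hypothesis k_gt0 : 0 < k.

Lemma tree_profile_mono x x' :
  (forall i, i < k -> x i <= x' i) -> tree_profile k d x -> tree_profile k d x'.
Proof.
move=> xx' tx; move: tx xx'; case=> {x} [x x0|x y z xyz yd zd ty tz] xx'.
  by apply: tree_leaf; apply: leq_trans (xx' 0 k_gt0).
apply: (tree_node (y := y) (z := z)) => // i ik.
exact: leq_trans (xyz i ik) (xx' _ ik).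
Qed.

Lemma sum_single_profile n h a :
  \sum_(i < n) (if i == h :> nat then a else 0) <= a.
Proof.
have [hn|nh] := ltnP h n.
  by rewrite -big_mkcond (big_pred1 (Ordinal hn)).
by rewrite big1 // => i _; case: eqP => // E; move: (ltn_ord i); rewrite E ltnNge nh.
Qed.

Lemma tree_profile_complete h : h < k -> 2 ^ h <= d ->
  tree_profile k d (fun i => if i == h then 2 ^ h else 0).
Proof.
elim: h => [|h IH] hk hd; first exact: tree_leaf.
have hd' : 2 ^ h <= d by apply: leq_trans hd; rewrite leq_exp2l.
have IHh := IH (ltnW hk) hd'.
apply: (tree_node _ _ _ IHh IHh) => [i ik||]; last 2 first.
- exact: leq_trans (sum_single_profile _ _ _) hd'.
- exact: leq_trans (sum_single_profile _ _ _) hd'.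
by rewrite eqSS expnS mul2n -addnn; case: eqP.
Qed.

(** Here [r] levels are built at once above [2 ^ r] subtrees with profiles [y c]. A node [s] levels
    above their roots sees [2 ^ s] of them, each only up to distance [k - s]; [s < r] leaves out the
    root of the whole tree. *)
Lemma tree_profile_levels r (y : nat -> nat -> nat) x :
  (forall c, c < 2 ^ r -> tree_profile k d (y c)) ->
  (forall c s, c < 2 ^ r -> s < r -> 2 ^ s * \sum_(i < k - s) y c i <= d) ->
  (forall i, i + r < k -> \sum_(c < 2 ^ r) y c i <= x (i + r)) ->
  tree_profile k d x.
Proof.
elim: r x y => [|r IH] x y ty yd yx.
  apply: (tree_profile_mono _ (ty 0 _)) => // i ik.
  have := yx i; rewrite addn0 => /(_ ik); apply: leq_trans.
  by rewrite big_ord_recl leq_addr.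
(* The profile of a child of the root, which lies [r] levels above its half of the subtrees. *)
pose half (z : nat -> nat -> nat) i :=
  if r <= i then \sum_(c < 2 ^ r) z c (i - r) else 0.
have half_tree z : (forall c, c < 2 ^ r -> tree_profile k d (z c)) ->
    (forall c s, c < 2 ^ r -> s < r.+1 -> 2 ^ s * \sum_(i < k - s) z c i <= d) ->
    tree_profile k d (half z) /\ \sum_(i < k) half z i <= d.
  move=> tz zd; split.
    apply: (IH _ z) => // [c s c2 sr|i ik]; first by apply: zd => //; apply: leqW.
    by rewrite /half leq_addl addnK.
  have [kr|rk] := leqP k r.
    by rewrite big1 // => i _; rewrite /half leqNgt (leq_trans (ltn_ord i) kr).
  rewrite -(big_mkord xpredT (half z)) (big_cat_nat (n := r)) //=; last exact: ltnW.
  rewrite big_nat_cond big1 ?add0n; last first.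
    by move=> i /andP[/andP[_ ir] _]; rewrite /half leqNgt ir.
  rewrite -{1}(add0n r) big_addn big_mkord.
  under eq_bigr do rewrite /half leq_addl addnK.
  rewrite exchange_big /= -(leq_pmul2l (expn_gt0 2 r)) big_distrr /=.
  apply: (@leq_trans (\sum_(c < 2 ^ r) d)); last by rewrite sum_nat_const card_ord.
  by apply: leq_sum => c _; apply: zd.
have r2 : 2 ^ r.+1 = 2 ^ r + 2 ^ r by rewrite expnS mul2n addnn.
have [||t1 s1] := half_tree y.
- by move=> c c2; apply: ty; rewrite r2 (leq_trans c2) ?leq_addr.
- by move=> c s c2 sr; apply: yd => //; rewrite r2 (leq_trans c2) ?leq_addr.
have [||t2 s2] := half_tree (fun c => y (2 ^ r + c)).
- by move=> c c2; apply: ty; rewrite r2 ltn_add2l.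
- by move=> c s c2 sr; apply: yd => //; rewrite r2 ltn_add2l.
apply: (tree_node _ s1 s2 t1 t2) => i ik; rewrite /half.
case: (leqP r i) => ri; last by [].

have := yx (i - r); rewrite addnS subnK // => /(_ ik); apply: leq_trans.
by rewrite r2 big_split_ord.
Qed.

End TreeConstruction.

(** * Block profiles, one round of the construction, and the start at the root *)

Section Profiles.
Variables (R : realType) (K d r N : nat).
Local Open Scope ring_scope.
Hypotheses (r_gt0 : (0 < r)%N) (N_gt0 : (0 < N)%N).
Hypotheses (rN_le : (r * N + r <= K)%N) (rN_ge : (K <= r * N + r.*2)%N).
Hypothesis d_ge : (2 ^ (3 * r) <= d)%N.

(** Distances are counted downwards from [K] and grouped into [N] blocks of length [r]. The factor
    [b m] is the density of block [m], relative to [d / 2 ^ (K - i)]; plain halving keeps the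
    constant [1 / 2]. A round moves the leaves of block [m] to block [m + 1]. *)
Definition block_profile (b : nat -> R) (i : nat) : nat :=
  if (i <= K)%N && (K - i < r * N)%N
  then Num.truncn (d%:R / 2 ^+ (K - i) * b ((K - i) %/ r)%N) else 0%N.

(** The condition of [tree_profile_levels] on a subtree, with [k = K + 1]. *)
Definition block_admissible (b : nat -> R) : Prop :=
  forall s, (s < r)%N ->
    (2 ^ s * \sum_(i < K.+1 - s) block_profile b i <= d)%N.

Lemma block_profile_le b i : (forall m, 0 <= b m) ->
  (block_profile b i)%:R <= d%:R / 2 ^+ (K - i) * b ((K - i) %/ r)%N.
Proof.
move=> b0; rewrite /block_profile; case: ifP => _; last by rewrite mulr_ge0 // divr_ge0.
by rewrite truncn_le mulr_ge0 // divr_ge0.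
Qed.

(** Since [s < r], the block index of [s + u] is at most [u], so the sum is dominated by the
    geometric series of ratio [q = (1 + 2 * eta) / 2], whose prefactor [1 / 2 - eta] is exactly
    [1 - q]. *)
Lemma block_admissible_geometric (b : nat -> R) (eta : R) :
  0 <= eta < 2^-1 ->
  (forall m, 0 <= b m <= (2^-1 - eta) * (1 + 2 * eta) ^+ m) ->
  block_admissible b.
Proof.
move=> /andP[eta0 eta1] bm s sr.
pose q : R := (1 + 2 * eta) / 2.
have q0 : 0 <= q by rewrite divr_ge0 // addr_ge0 ?mulr_ge0.
have be0 : 0 <= 2^-1 - eta by rewrite subr_ge0 ltW.
have q1 : 1 - q = 2^-1 - eta by rewrite /q; field.
rewrite (reindex_inj rev_ord_inj) /= -(ler_nat R) natrM natr_sum natrX.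
apply: (@le_trans _ _ (2 ^+ s * \sum_(u < K.+1 - s)
    d%:R / 2 ^+ (s + u) * ((2^-1 - eta) * (1 + 2 * eta) ^+ u))).
  rewrite ler_wpM2l // ler_sum // => u _.
  apply: le_trans (block_profile_le _ _) _; first by move=> m; case/andP: (bm m).
  have -> : (K - (K.+1 - s - u.+1) = s + u)%N by have := ltn_ord u; clear; lia.
  rewrite ler_wpM2l ?divr_ge0 //; case/andP: (bm ((s + u) %/ r)%N) => _ /le_trans; apply.
  rewrite ler_wpM2l // ler_weXn2l ?lerDl ?mulr_ge0 //.
  rewrite -ltnS ltn_divLR // mulSn.
  by have := leq_pmulr u r_gt0; move: sr; clear; lia.
have -> : 2 ^+ s * \sum_(u < K.+1 - s)
    d%:R / 2 ^+ (s + u) * ((2^-1 - eta) * (1 + 2 * eta) ^+ u) =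
    d%:R * ((1 - q) * \sum_(u < K.+1 - s) q ^+ u).
  rewrite q1 !mulr_sumr; apply: eq_bigr => u _; rewrite /q expr_div_n exprD.
  by field; rewrite ?expf_neq0.
rewrite -opprB mulNr -subrX1 opprB ler_piMr //.
by rewrite gerBl exprn_ge0.
Qed.

(** Of the [2 ^ r] descendants, [r * p] become complete trees absorbing the last block, [p] for each
    of its [r] distances; the others share the remaining leaves. If [r * p] reaches [2 ^ r], nobody
    is left and the construction ends. Block [0] of [b'] lies too deep to be seen from the root,
    hence the index [m.+1]. *)
Lemma block_round (b b' : nat -> R) (p := Num.truncn (d%:R / 2 ^+ K * 2 ^+ r * b N.-1)) :
  (forall m, 0 <= b m) -> (forall m, 0 <= b' m) ->
  ((r * p < 2 ^ r)%N ->
     [/\ tree_profile K.+1 d (block_profile b'), block_admissible b' &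
         forall m, (m.+1 < N)%N ->
           (2 ^ r - r * p)%:R * b' m.+1 <= 2 ^+ r * b m]) ->
  tree_profile K.+1 d (block_profile b).
Proof.
move=> b0 b'0 next.
(* The height of the complete trees for the position [a] in the last block; it is at most [2 * r],
   which is why [2 ^ (3 * r) <= d] suffices. *)
pose h a := (K - r * N - a)%N.
pose y c := if (c < r * p)%N
  then (fun i => if i == h (c %/ p)%N then 2 ^ h (c %/ p) else 0)%N
  else block_profile b'.
have hd a : (2 ^ h a <= 2 ^ r.*2)%N.
  by rewrite leq_exp2l // /h; lia.
have p0 c : (c < r * p)%N -> (0 < p)%N by case: (posnP p) => // ->; rewrite muln0.
apply: (@tree_profile_levels _ _ _ r y).
- by [].
- move=> c c2; rewrite /y; case: ifP => [crp|/negbT]; last first.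
    by rewrite -leqNgt => /leq_ltn_trans/(_ c2)/next[].
  apply: tree_profile_complete; first by rewrite ltnS /h -subnDA leq_subr.
  by apply: leq_trans (hd _) (leq_trans _ d_ge); rewrite leq_exp2l //; lia.
- move=> c s c2 sr; rewrite /y; case: ifP => [crp|/negbT]; last first.
    by rewrite -leqNgt => /leq_ltn_trans/(_ c2)/next[_ + _]; apply.
  apply: leq_trans (leq_mul (leqnn _) (sum_single_profile _ _ _)) _.
  apply: leq_trans (leq_mul (leqnn _) (hd _)) _.
  by rewrite -expnD (leq_trans _ d_ge) // leq_exp2l //; lia.
move=> i iK.
pose j := (K - (i + r))%N; have Ki : (K - i = j + r)%N by rewrite /j; lia.
rewrite [leqRHS]/block_profile -/j.
have -> /= : (i + r <= K)%N by lia.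
(* Before the last block only the incomplete descendants contribute; in the last block only the
   complete ones; beyond it nothing does. *)
have [jN1|jN1] := ltnP j (r * N.-1).
  have jN : (j < r * N)%N by rewrite (leq_trans jN1) // leq_mul2l leq_pred orbT.
  have jN' : (j + r < r * N)%N by rewrite -(prednK N_gt0) mulnS; lia.
  rewrite jN.
  have yE c : y c i = (if c < r * p then 0 else block_profile b' i)%N.
    rewrite /y; case: ifP => // crp; case: eqP => // E; exfalso.
    have := ltn_divLR c r (p0 _ crp); rewrite crp => cr.
    by move: (c %/ p)%N cr E => a ar E; move: jN' rN_le; rewrite -Ki E /h; clear; lia.
  under eq_bigr do rewrite yE.
  rewrite -(big_mkord xpredT (fun c => if c < r * p then 0 else block_profile b' i)%N).
  have [rp|rp] := leqP (2 ^ r) (r * p).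
    rewrite big_nat_cond big1 // => c /andP[/andP[_ c2] _].
    by rewrite (leq_trans c2 rp).
  rewrite (big_cat_nat (n := (r * p)%N)) //=; last exact: ltnW.
  rewrite big_nat_cond big1 ?add0n; last first.
    by move=> c /andP[/andP[_ ->]].
  rewrite big_nat_cond (eq_bigr (fun=> block_profile b' i)) -?big_nat_cond; last first.
    by move=> c /andP[/andP[rc _] _]; rewrite ltnNge rc.
  rewrite sum_nat_const_nat truncn_ge_nat; last by rewrite mulr_ge0 // divr_ge0.
  rewrite natrM; have [_ _ bb] := next rp.
  apply: le_trans (ler_wpM2l (ler0n _ _) (block_profile_le _ b'0)) _.
  rewrite Ki divnDr // divnn r_gt0 addn1.
  have {bb} := bb (j %/ r)%N; rewrite -ltn_predRL ltn_divLR // mulnC => /(_ jN1) bb.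
  rewrite exprD invfM mulrCA -!mulrA ler_wpM2l // ler_wpM2l ?invr_ge0 //.
  by rewrite ler_pdivrMl ?exprn_gt0.
have [jN|jN] := ltnP j (r * N); last first.
  rewrite big1 // => c _; rewrite /y; case: ifP => [crp|_]; last first.
    by rewrite /block_profile Ki; case: ifP => //; lia.
  have := ltn_divLR c r (p0 _ crp); rewrite crp => cr.
  case: eqP => // E; exfalso; move: (c %/ p)%N cr E => a ar E.
  by move: jN rN_le iK ar; rewrite /j E /h; clear; lia.
pose a := (j - r * N.-1)%N.
have rNE : (r * N = r + r * N.-1)%N by rewrite -mulnS prednK.
have jr : (j %/ r = N.-1)%N.
  apply/eqP; rewrite eqn_leq leq_divRL // mulnC jN1 andbT -ltnS prednK //.
  by rewrite ltn_divLR // mulnC.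
rewrite jr truncn_ge_nat; last by rewrite mulr_ge0 // divr_ge0.
have ai : (K - r * N - a = i)%N.
  by move: jN jN1 rN_le iK; rewrite /a rNE /j; clear; lia.
have y_le c : (y c i <= 2 ^ i * (a * p <= c < a * p + p))%N.
  rewrite /y; case: ifP => [crp|_]; last first.
    rewrite /block_profile Ki; case: ifP => //.
    by case/andP => _; rewrite ltnNge rNE addnC leq_add2r jN1.
  case: eqP => // E; rewrite -E -{1}(muln1 (2 ^ i)%N) leq_mul2l; apply/orP; right.
  have := ltn_divLR c r (p0 _ crp); rewrite crp => cr.
  have -> : a = (c %/ p)%N.
    by move: (c %/ p)%N cr E => a' ar E; move: ai ar rN_le; rewrite E /h; clear; lia.
  by rewrite leq_divM /= -mulSnr ltn_ceil ?(p0 _ crp).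
apply: (@le_trans _ _ (2 ^ i * p)%:R).
  rewrite ler_nat.
  apply: (@leq_trans (\sum_(c < 2 ^ r) 2 ^ i * (a * p <= c < a * p + p))%N).
    by apply: leq_sum => c _; apply: y_le.
  by rewrite -big_distrr leq_mul2l sum_interval orbT.
rewrite natrM natrX.
apply: le_trans (ler_wpM2l _ (_ : p%:R <= d%:R / 2 ^+ K * 2 ^+ r * b N.-1)) _.
- by [].
- by rewrite truncn_le !mulr_ge0 // invr_ge0.
have -> : (K = i + r + j)%N by rewrite /j; lia.
rewrite !exprD le_eqVlt; apply/orP; left; apply/eqP.
by field; rewrite !expf_neq0.
Qed.

(** Below a root that sees no leaf, each level brings one further distance into view: [z L] is the
    profile after [L] levels. The leaves are split evenly at every node. *)
Lemma block_start (beta : R) :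
  block_admissible (fun=> beta) -> 0 <= beta ->
  tree_profile K.+1 d (block_profile (fun=> beta)) ->
  tree_profile K.+1 d (fun=> 0%N).
Proof.
move=> adm beta0 tb.
pose z L i := if (i <= K)%N && (K - i < L)%N
  then Num.truncn (d%:R / 2 ^+ (K - i) * beta) else 0%N.
suff : forall L, (L <= r * N)%N -> tree_profile K.+1 d (z L).
  move/(_ 0%N isT); apply: tree_profile_mono => // i _.
  by rewrite /z ltn0 andbF.
move=> L LN; rewrite -(subKn LN); elim: (r * N - L)%N => [|n IH].
  by rewrite subn0; apply: tree_profile_mono tb.
have [nN|nN] := leqP (r * N) n.
  have [E1 E2] : (r * N - n = 0 /\ r * N - n.+1 = 0)%N by move: nN; clear; lia.
  by move: IH; rewrite E1 E2.
have zsum : (\sum_(i < K.+1) z (r * N - n) i <= d)%N.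
  have := adm 0%N r_gt0; rewrite subn0 mul1n; apply: leq_trans.
  apply: leq_sum => i _; rewrite /z /block_profile; case: ifP => // /andP[-> h] /=.
  by rewrite (leq_trans h) // leq_subr.
apply: (tree_node _ zsum zsum IH IH) => i ik; rewrite /z.
case: ifP => [/andP[iK h]|_]; last by [].
have -> : ((i < K) && (K - i.+1 < r * N - n.+1))%N by move: ik iK h; clear; lia.
rewrite truncn_ge_nat; last by rewrite mulr_ge0 // divr_ge0.
rewrite natrD; set t := Num.truncn _.
have : t%:R <= d%:R / 2 ^+ (K - i) * beta by rewrite truncn_le mulr_ge0 // divr_ge0.
have -> : (K - i = (K - i.+1).+1)%N by move: ik; clear; lia.
rewrite exprS.
have -> : d%:R / (2 * 2 ^+ (K - i.+1)) * beta = (d%:R / 2 ^+ (K - i.+1) * beta) / 2.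
  by field; rewrite expf_neq0.
by rewrite ler_pdivlMr // mulr_natr -mulr2n.
Qed.

End Profiles.

(** * Iterating the rounds with slowly increasing densities *)

Section Growth.
Variables (R : realType) (K d r N : nat) (eta : R).
Local Open Scope ring_scope.
Hypotheses (r_gt0 : (0 < r)%N) (N_gt0 : (0 < N)%N).
Hypotheses (rN_le : (r * N + r <= K)%N) (rN_ge : (K <= r * N + r.*2)%N).
Hypothesis d_ge : (2 ^ (3 * r) <= d)%N.
Hypotheses (eta_gt0 : 0 < eta) (eta_lt : eta < 2^-1) (eta_ge : (2 ^+ r)^-1 <= eta).

Let beta : R := 2^-1 - eta.
Let A : R := d%:R / 2 ^+ K * r%:R * beta.

Hypothesis A_ge : forall v, 0 <= v ->
  v + (r%:R + 1) / 2 ^+ r <= A * (1 + v) ^+ N.-1.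
Hypothesis A_final : 1 + r%:R / 2 ^+ r <= A * (1 + eta / 2) ^+ N.-1.

(** So small that the growth rate changes by at most [2 ^ -r] over [N + 1] rounds. *)
Let sigma : R := (2 ^+ r)^-1 / N.+1%:R.
(* The subtraction [t - N] is truncated: the growth is constant up to time [N]. *)
Let g (t : nat) : R := 1 + sigma * (t - N)%:R.
(** The leaves in block [m] at time [T] have gone through the last [m] rounds and carry their growth
    factors. *)
Let b (T m : nat) : R := beta * \prod_(t < m) g (T - t)%N.
(** Late enough for the last [N - 1] growth rates to exceed [eta / 2], yet early enough for
    [g T0 <= 1 + 2 * eta], which keeps all profiles admissible. *)
Let T0 : nat := (2 * N + (Num.truncn (eta / 2 / sigma)).+1)%N.

Let beta_ge0 : 0 <= beta. Proof. by rewrite subr_ge0 ltW. Qed.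

Let sigma_gt0 : 0 < sigma.
Proof. by rewrite divr_gt0 ?invr_gt0 ?exprn_gt0. Qed.

Let sigmaN : sigma * N.+1%:R = (2 ^+ r)^-1.
Proof. by rewrite mulfVK. Qed.

Let g_ge1 t : 1 <= g t.
Proof. by rewrite lerDl mulr_ge0 // ltW. Qed.

Let g_le s t : (s <= t)%N -> g s <= g t.
Proof. by move=> st; rewrite lerD2l ler_wpM2l ?(ltW sigma_gt0) // ler_nat leq_sub2r. Qed.

Let bSS T m : b T.+1 m.+1 = g T.+1 * b T m.
Proof.
rewrite /b big_ord_recl subn0 mulrCA; congr (_ * (_ * _)).
Qed.

Let b_ge0 T m : 0 <= b T m.
Proof.
rewrite mulr_ge0 // prodr_ge0 // => t _; exact: le_trans ler01 (g_ge1 _).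
Qed.

Let g_T0 : g T0 <= 1 + 2 * eta.
Proof.
have h : (Num.truncn (eta / 2 / sigma))%:R <= eta / 2 / sigma.
  by rewrite truncn_le !divr_ge0 // ltW.
rewrite lerD2l; apply: (@le_trans _ _ (sigma * (N.+1%:R + eta / 2 / sigma))).
  rewrite ler_wpM2l ?(ltW sigma_gt0) //; apply: le_trans (lerD (lexx _) h).
  by rewrite -natrD ler_nat /T0; clear; lia.
rewrite mulrDr sigmaN mulrCA mulfV ?gt_eqF // mulr1.
apply: le_trans (lerD eta_ge (lexx _)) _.
by rewrite [leRHS]mulr_natl (mulr2n eta) lerD2l ler_pdivrMr // ler_peMr ?ler1n // ltW.
Qed.

Let b_le T m : (T <= T0)%N -> b T m <= beta * (1 + 2 * eta) ^+ m.
Proof.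
move=> TT; rewrite ler_wpM2l // -[m in leRHS]card_ord -prodr_const.
apply: ler_prod => t _; rewrite (le_trans ler01) //=.
by apply: le_trans g_T0; apply: g_le; apply: leq_trans (leq_subr _ _) TT.
Qed.

Let b_adm T : (T <= T0)%N -> block_admissible K d r N (b T).
Proof.
move=> TT; apply: (@block_admissible_geometric _ _ _ _ _ r_gt0 _ eta).
  by rewrite ltW.
by move=> m; rewrite b_ge0 b_le.
Qed.

Let wins T : nat := (r * Num.truncn (d%:R / 2 ^+ K * 2 ^+ r * b T N.-1))%N.

(** The density of the last block is a product of [N - 1] factors, each at least [1 + v]; rounding
    [p] down costs less than [r] descendants. *)
Let wins_gt T (v : R) : 0 <= v -> v <= sigma * (T.+1 - 2 * N)%:R ->
  2 ^+ r * (A * (1 + v) ^+ N.-1) - r%:R < (wins T)%:R.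
Proof.
move=> v0 vT.
set X := d%:R / 2 ^+ K * 2 ^+ r * b T N.-1.
have h : r%:R * X < r%:R * (Num.truncn X).+1%:R.
  by rewrite ltr_pM2l ?ltr0n // truncnS_gt.
rewrite ltrBlDr /wins natrM -/X.
have -> : r%:R * (Num.truncn X)%:R + r%:R = r%:R * (Num.truncn X).+1%:R :> R.
  by rewrite -natr1 mulrDr mulr1.
apply: le_lt_trans h.
have -> : r%:R * X = 2 ^+ r * (A * \prod_(t < N.-1) g (T - t)%N).
  by rewrite /X /b /A; ring.
have A_ge0 : 0 <= A by rewrite !mulr_ge0 ?invr_ge0.
rewrite ler_wpM2l ?exprn_ge0 // ler_wpM2l //.
rewrite -[N.-1 in leLHS]card_ord -prodr_const; apply: ler_prod => t _.
rewrite addr_ge0 //= lerD2l (le_trans vT) // ler_wpM2l ?(ltW sigma_gt0) // ler_nat.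
by have := ltn_ord t; clear; lia.
Qed.

Lemma tree_profile_growth : tree_profile K.+1 d (fun=> 0%N).
Proof.
have start : b 0 = fun=> beta.
  apply/funext => m; rewrite /b big1 ?mulr1 // => t _.
  by rewrite /g !sub0n mulr0 addr0.
apply: (block_start (beta := beta) r_gt0 _ beta_ge0); rewrite -start.
  exact: b_adm.
suff main n T : (T + n = T0)%N -> tree_profile K.+1 d (block_profile K d r N (b T)).
  exact: (main T0).
(* Induction backwards in time. At [T0] the hypothesis [A_final] makes every descendant complete. *)
elim: n T => [|n IH] T TT;
  apply: (block_round r_gt0 N_gt0 rN_le rN_ge d_ge (b' := b T.+1)) => //.
  rewrite -/(wins T) => wT; exfalso.
  have e0 : 0 <= eta / 2 by rewrite divr_ge0 // ltW.
  have eT : eta / 2 <= sigma * (T.+1 - 2 * N)%:R.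
    rewrite -ler_pdivrMl // mulrC; apply: le_trans (ltW (truncnS_gt _)) _.
    by rewrite ler_nat -(addn0 T) TT /T0 -addnS addKn leqnSn.
  have := wins_gt e0 eT; apply/negP; rewrite -leNgt.
  apply: (@le_trans _ _ (2 ^+ r)); first by rewrite -natrX ler_nat ltnW.
  rewrite lerBrDr.
  have := ler_wpM2l (exprn_ge0 r (ler0n R 2)) A_final.
  by rewrite mulrDr mulr1 mulrCA mulfV ?expf_neq0 // mulr1.
rewrite -/(wins T) => wT; split.
- by apply: IH; rewrite addSn -addnS.
- by apply: b_adm; move: TT; clear; lia.
move=> m mN; rewrite bSS mulrA ler_wpM2r //.
pose v : R := sigma * (T.+1 - 2 * N)%:R.
have v0 : 0 <= v by rewrite mulr_ge0 // ltW.
have := wins_gt v0 (lexx _).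
have := ler_wpM2l (exprn_ge0 r (ler0n R 2)) (A_ge v0).
have -> : 2 ^+ r * (v + (r%:R + 1) / 2 ^+ r) = 2 ^+ r * v + r%:R + 1.
  by field; rewrite expf_neq0.
rewrite natrB 1?ltnW // natrX.
set w := (wins T)%:R; set Y := 2 ^+ r * (A * _) => h1 h2.
have h3 : 2 ^+ r * v + 1 <= w.
  by have := ltW (le_lt_trans (lerD h1 (lexx (- r%:R))) h2); rewrite addrAC addrK.
set v' := sigma * (T.+1 - N)%:R.
(* The new rate [v'] exceeds the older rate [v] by at most [2 ^ -r], so [A_ge] makes at least a
   fraction [v'] of the descendants complete. The growth [1 + v'] is affordable because
   [(1 - v') * (1 + v') <= 1]. *)
have vv' : v' <= v + (2 ^+ r)^-1.
  rewrite -sigmaN -mulrDr ler_wpM2l ?(ltW sigma_gt0) // -natrD ler_nat.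
  by clear; lia.
have v'0 : 0 <= v' by rewrite mulr_ge0 // ltW.
have h4 : 2 ^+ r * v' <= w.
  apply: le_trans h3; apply: le_trans (ler_wpM2l _ vv') _; first by rewrite exprn_ge0.
  by rewrite mulrDr mulfV ?expf_neq0.
have -> : g T.+1 = 1 + v' by [].
apply: (@le_trans _ _ ((2 ^+ r - 2 ^+ r * v') * (1 + v'))).
  by rewrite ler_wpM2r ?addr_ge0 // lerD2l lerN2.
have -> : (2 ^+ r - 2 ^+ r * v') * (1 + v') = 2 ^+ r - 2 ^+ r * v' ^+ 2 by ring.
by rewrite gerBl mulr_ge0 ?exprn_ge0.
Qed.

End Growth.

(** * Choice of the round length *)

Section Estimates.
Variable R : realType.
Local Open Scope ring_scope.

Lemma bernoulli_ge (x : R) n : 0 <= x -> 1 + n%:R * x <= (1 + x) ^+ n.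
Proof.
move=> x0; elim: n => [|n IH]; first by rewrite expr0 mul0r addr0.
rewrite exprS -natr1; apply: le_trans (ler_wpM2l _ IH); last by rewrite addr_ge0.
have : 0 <= n%:R * (x * x) by rewrite !mulr_ge0.
move: (n%:R : R) => m; clear IH; nra.
Qed.

Lemma expR1_le4 : expR 1 <= 4 :> R.
Proof.
have h : expR 2^-1 <= 2 :> R.
  rewrite -[leLHS]invrK -expRN invf_ple ?posrE ?expR_gt0 //.
  by apply: le_trans (expR_ge1Dx _); lra.
rewrite [X in expR X](_ : 1 = 2^-1 + 2^-1); last by field.
by rewrite expRD (_ : 4 = 2 * 2) ?ler_pM ?expR_ge0 //; ring.
Qed.

(* With [s = v / (1 + v)] this is [n * s <= expR (n * s - 1)] together with
   [1 - s <= expR (- s)]. *)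
Lemma mul_le_exprS (n : nat) (v : R) : 0 <= v ->
  expR 1 * (n%:R * v) <= (1 + v) ^+ n.+1.
Proof.
move=> v0; have v1 : 0 < 1 + v by rewrite ltr_wpDr.
pose s := v / (1 + v).
have es : expR s <= 1 + v.
  rewrite -[leLHS]invrK -expRN invf_ple ?posrE ?expR_gt0 //.
  apply: le_trans (expR_ge1Dx _); rewrite le_eqVlt /s; apply/orP; left.
  by apply/eqP; field; rewrite gt_eqF.
have ns : expR 1 * (n%:R * s) <= expR s ^+ n.
  rewrite -expRM_natl -ler_pdivlMl ?expR_gt0 // -expRN -expRD.
  by apply: le_trans (expR_ge1Dx _); rewrite addNKr.
have vE : v = s * (1 + v) by rewrite divfK ?gt_eqF.
have -> : expR 1 * (n%:R * v) = expR 1 * (n%:R * s) * (1 + v).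
  by rewrite {1}vE !mulrA.
rewrite exprSr ler_pM2r //; apply: le_trans ns _.
by rewrite lerXn2r ?nnegrE ?expR_ge0 // ltW.
Qed.

(** The bound [255] gives [256 <= r + 1], whence [r + 1 <= (m + 1) ^ 2]; then [m + 1 <= 2 ^ m] is
    raised to the power [16]. *)
Lemma expr2_ge_expS8 (r : nat) : (255 <= r)%N -> (r.+1 ^ 8 <= 2 ^ r)%N.
Proof.
move=> r255; pose m := (r %/ 16)%N.
have rm : (r.+1 <= 16 * m.+1)%N by rewrite mulnC ltn_ceil.
have h : (r.+1 <= m.+1 ^ 2)%N.
  rewrite -(leq_pmul2l (m := 256)) //.
  apply: (@leq_trans (r.+1 * r.+1)%N); first by rewrite leq_mul2r; lia.
  apply: leq_trans (leq_mul rm rm) _.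
  by rewrite mulnACA -mulnn leq_mul2r; lia.
apply: (@leq_trans (2 ^ (16 * m))%N); last first.
  by rewrite leq_exp2l // mulnC leq_divM.
rewrite mulnC expnM; apply: (@leq_trans (m.+1 ^ 16)%N).
  by rewrite (expnM _ 2 8) leq_exp2r.
by rewrite leq_exp2r // ltn_expl.
Qed.

End Estimates.

(** * Verification of the growth conditions for [r ^ 4] close to [K] *)

Section Calibration.
Variables (R : realType) (r K d : nat).
Local Open Scope ring_scope.
Hypotheses (r_ge : (255 <= r)%N) (K_ge : (r ^ 4 <= K)%N) (K_lt : (K < r.+1 ^ 4)%N).
Hypothesis d_ge :
  2 / expR 1 * (1 + 10 / r%:R ^+ 2) * (2 ^+ K / K%:R) <= d%:R :> R.

Let N := (K %/ r).-1.
Let x : R := r%:R.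
Let L : R := K%:R.
Let eta : R := (x ^+ 2)^-1.
Let A : R := d%:R / 2 ^+ K * x * (2^-1 - eta).
Let y : R := r.+1%:R.

Let r_gt0 : (0 < r)%N. Proof. exact: leq_trans r_ge. Qed.

Let K_gt0 : (0 < K)%N.
Proof. by apply: leq_trans K_ge; rewrite expn_gt0 r_gt0. Qed.

Let NS : N.+1 = (K %/ r)%N.
Proof.
rewrite prednK // divn_gt0 //; apply: leq_trans K_ge.
by rewrite (expnS r 3) leq_pmulr // expn_gt0 r_gt0.
Qed.

Let N_ge : (r ^ 2 * r.-1 <= N.-1)%N.
Proof.
have : (r ^ 3 <= N.+1)%N by rewrite NS leq_divRL // -expnSr.
have -> : (r ^ 3 = r ^ 2 * r.-1 + r ^ 2)%N by rewrite addnC -mulnS prednK // expnSr.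
have : (2 <= r ^ 2)%N by rewrite -mulnn (leq_trans _ (leq_mul r_ge r_ge)).
by clear; lia.
Qed.

Let N_ge2 : (2 <= N)%N.
Proof.
suff : (0 < N.-1)%N by case: N => [|[]].
apply: leq_trans N_ge; rewrite muln_gt0 expn_gt0 r_gt0 /= -ltnS prednK //.
exact: leq_trans r_ge.
Qed.

Let rN_le : (r * N + r <= K)%N.
Proof. by rewrite addnC -mulnS NS mulnC leq_divM. Qed.

Let rN_gt : (K < r * N + r.*2)%N.
Proof. by rewrite -addnn addnA -!mulnSr NS mulnC ltn_ceil. Qed.

Let x_ge : 255 <= x. Proof. by rewrite ler_nat. Qed.
Let x_gt0 : 0 < x. Proof. by rewrite ltr0n. Qed.
Let L_gt0 : 0 < L. Proof. by rewrite ltr0n. Qed.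
Let y_def : y = x + 1. Proof. by rewrite /y -natr1. Qed.
Let L_ge : x ^+ 4 <= L. Proof. by rewrite -natrX ler_nat. Qed.
Let L_le : L <= y ^+ 4. Proof. by rewrite -natrX ler_nat ltnW. Qed.

Let x_ge0 := ltW x_gt0.
Let L_ge0 := ltW L_gt0.
Let y_gt0 : 0 < y. Proof. by rewrite ltr0n. Qed.
Let y_ge0 := ltW y_gt0.

Let pow_ge : y ^+ 8 <= 2 ^+ r.
Proof. by rewrite -!natrX ler_nat expr2_ge_expS8. Qed.

Let eta_gt0 : 0 < eta. Proof. by rewrite invr_gt0 exprn_gt0. Qed.

Let eta_ge0 := ltW eta_gt0.

Let eta_le : eta <= 100^-1.
Proof.
rewrite lef_pV2 ?posrE ?exprn_gt0 //.
by move: x_ge; move: x => z hz; nra.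
Qed.

Let d_pow : (2 ^ (3 * r) <= d)%N.
Proof.
pose m := (K - (3 * r).+1)%N.
have K8 : (8 * r <= K)%N.
  apply: leq_trans K_ge; rewrite (expnS r 3) mulnC leq_mul2l.
  rewrite (expnS r 2) (leq_trans _ (leq_pmulr r _)) ?expn_gt0 ?r_gt0 ?orbT //.
  exact: leq_trans r_ge.
have Km : (K <= 2 ^ m)%N.
  have m255 : (255 <= m)%N by rewrite /m; move: K8 r_ge; clear; lia.
  apply: leq_trans (expr2_ge_expS8 m255).
  apply: (@leq_trans (m.+1 ^ 2)%N); last by rewrite leq_pexp2l.
  rewrite -mulnn; apply: (@leq_trans (2 * m.+1)%N).
    by rewrite /m; move: K8; clear; lia.
  by rewrite leq_mul2r ltnS (leq_trans _ m255).
have h : (2 ^ (3 * r) * (2 * K) <= 2 ^ K)%N.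
  have -> : (2 ^ K = 2 ^ (3 * r) * (2 * 2 ^ m))%N.
    by rewrite -expnS -expnD; congr (2 ^ _)%N; rewrite /m; move: K8 r_gt0; clear; lia.
  by rewrite !leq_mul2l Km !orbT.
rewrite -(ler_nat R); apply: le_trans d_ge; rewrite -/x -/L.
apply: (@le_trans _ _ (2^-1 * 1 * (2 ^+ K / L))).
  rewrite mulr1 ler_pdivlMl // ler_pdivlMr //.
  have -> : 2 * (2 ^ (3 * r))%:R * L = (2 ^ (3 * r) * (2 * K))%:R.
    by rewrite !natrM mulrA (mulrC 2).
  by rewrite -natrX ler_nat.
rewrite ler_pM2r ?divr_gt0 ?exprn_gt0 // ler_pM ?invr_ge0 //.
  rewrite ler_pdivlMr ?expR_gt0 //; have := expR1_le4 R.
  by move: (expR 1) => e; lra.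
by rewrite lerDl divr_ge0 // exprn_ge0 // ltW.
Qed.

(** The factor [1 - 2 * eta] lost in the initial density reduces the surplus [10 * eta] to
    [6 * eta]. *)
Let A_lower : (expR 1)^-1 * ((1 + 6 * eta) * (x / L)) <= A.
Proof.
apply: (@le_trans _ _ (2 / expR 1 * (1 + 10 / x ^+ 2) * (2 ^+ K / L) / 2 ^+ K * x *
    (2^-1 - eta))); last first.
  rewrite ler_pM2r; last by move: eta_le; move: eta => t; lra.
  by rewrite ler_pM2r // ler_pM2r ?invr_gt0 ?exprn_gt0.
have -> : 2 / expR 1 * (1 + 10 / x ^+ 2) * (2 ^+ K / L) / 2 ^+ K * x * (2^-1 - eta)
  = (expR 1)^-1 * ((1 + 10 * eta) * (1 - 2 * eta) * (x / L)).
  rewrite -/eta; field.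
  by rewrite !gt_eqF ?expR_gt0 ?exprn_gt0.
rewrite ler_pM2l ?invr_gt0 ?expR_gt0 // ler_pM2r ?divr_gt0 //.
move: eta_gt0 eta_le; move: eta => t; nra.
Qed.

Let A_lower4 : x / (4 * y ^+ 4) <= A.
Proof.
apply: le_trans A_lower.
apply: (@le_trans _ _ (4^-1 * (1 * (x / L)))).
  rewrite mul1r invfM mulrCA ler_pM2l ?invr_gt0 // ler_pM2l //.
  by rewrite lef_pV2 ?posrE ?exprn_gt0.
have xL : 0 < x / L by rewrite divr_gt0.
apply: ler_pM => //; first by rewrite mul1r ltW.
  by rewrite lef_pV2 ?posrE ?expR_gt0 // expR1_le4.
by rewrite ler_pM2r // lerDl mulr_ge0 // ltW.
Qed.

Let A_ge0 : 0 <= A.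
Proof. by apply: le_trans A_lower4; rewrite divr_ge0 ?mulr_ge0. Qed.

(** Replacing [K] by [r * (N - 2)] costs a factor [1 - eta], so [mul_le_exprS] leaves a surplus
    [4 * eta * v]. It absorbs the error [delta] unless [v] is tiny, and then [A] alone exceeds
    [v + delta]. *)
Let A_growth v : 0 <= v -> v + (x + 1) / 2 ^+ r <= A * (1 + v) ^+ N.-1.
Proof.
move=> v0; pose delta := (x + 1) / 2 ^+ r; rewrite -/delta.
have delta_le : delta <= (y ^+ 7)^-1.
  rewrite /delta -y_def ler_pdivrMr ?exprn_gt0 // ler_pdivlMl ?exprn_gt0 //.
  by rewrite -exprSr.
have large : (1 + 4 * eta) * v <= A * (1 + v) ^+ N.-1.
  pose M : R := (N - 2)%:R.
  have NM : expR 1 * (M * v) <= (1 + v) ^+ N.-1.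
    have -> : N.-1 = (N - 2).+1 by move: N_ge2; clear; lia.
    exact: mul_le_exprS.
  have xM : (1 - eta) * L <= x * M.
    rewrite mulrBl mul1r lerBlDr; apply: (@le_trans _ _ (x * M + 4 * x)).
      have -> : x * M + 4 * x = (r * (N - 2 + 4))%:R by rewrite natrM natrD -/x -/M; ring.
      rewrite ler_nat.
      apply: leq_trans (ltnW rN_gt) _; rewrite -muln2 -mulnDr leq_mul2l.
      by move: N_ge2; clear; lia.
    rewrite lerD2l /eta ler_pdivlMl ?exprn_gt0 //; apply: le_trans L_ge.
    have -> : x ^+ 2 * (4 * x) = 4 * x ^+ 3 by ring.
    by rewrite (exprS x 3) ler_wpM2r ?exprn_ge0 //; move: x_ge; move: x => t; lra.
  apply: (@le_trans _ _ ((expR 1)^-1 * ((1 + 6 * eta) * (x / L)) *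
      (expR 1 * (M * v)))); last first.
    apply: ler_pM => //.
    - by rewrite mulr_ge0 ?invr_ge0 ?expR_ge0 // !mulr_ge0 ?invr_ge0 ?addr_ge0 ?mulr_ge0.
    - by rewrite !mulr_ge0 ?expR_ge0.
  have -> : (expR 1)^-1 * ((1 + 6 * eta) * (x / L)) * (expR 1 * (M * v)) =
      (1 + 6 * eta) * (x * M / L) * v.
    by field; rewrite !gt_eqF ?expR_gt0.
  rewrite ler_wpM2r //; apply: (@le_trans _ _ ((1 + 6 * eta) * (1 - eta))).
    by move: eta_gt0 eta_le; move: eta => t; nra.
  rewrite ler_wpM2l ?ler_pdivlMr // addr_ge0 // mulr_ge0 // ltW.
have [v_large|v_small] := leP delta (4 * eta * v).
  by apply: le_trans large; rewrite mulrDl mul1r lerD2l.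
have vy : v + delta <= (y ^+ 5)^-1.
  have -> : (y ^+ 5)^-1 = y ^+ 2 * (y ^+ 7)^-1.
    by field; rewrite gt_eqF.
  apply: (@le_trans _ _ (y ^+ 2 * delta)); last by rewrite ler_wpM2l // exprn_ge0 // ltW.
  have : v <= x ^+ 2 * delta / 4.
    rewrite ler_pdivlMr // -ler_pdivrMl ?exprn_gt0 // -/eta.
    by move: (ltW v_small); congr (_ <= _); ring.
  have : 0 <= delta by rewrite divr_ge0 // addr_ge0 // ltW.
  move=> delta0 v_le; rewrite y_def.
  apply: (@le_trans _ _ (x ^+ 2 * delta / 4 + delta)); first by rewrite lerD2r.
  have -> : (x + 1) ^+ 2 * delta =
      x ^+ 2 * delta / 4 + delta + (3 / 4 * x ^+ 2 + 2 * x) * delta by field.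
  by rewrite lerDl mulr_ge0 // addr_ge0 ?mulr_ge0 ?sqr_ge0.
apply: le_trans vy _; apply: (@le_trans _ _ A).
  apply: le_trans A_lower4.
  rewrite ler_pdivlMr ?mulr_gt0 ?exprn_gt0 //.
  have -> : (y ^+ 5)^-1 * (4 * y ^+ 4) = 4 / y by field; rewrite gt_eqF.
  rewrite ler_pdivrMr // y_def; move: x_ge; move: x => t; nra.
by rewrite ler_peMr // exprn_ege1 // lerDl.
Qed.

(** By Bernoulli, [r ^ 2] factors [1 + eta / 2] give at least [3 / 2], and there are [r - 1] such
    groups. Since [(3 / 2) ^ 2 >= 2], this outweighs the order [r ^ -3] of [A]. *)
Let A_final : 1 + x / 2 ^+ r <= A * (1 + eta / 2) ^+ N.-1.
Proof.
have e1 : 1 <= 1 + eta / 2 by rewrite lerDl divr_ge0 // ltW.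
have half : 3 / 2 <= (1 + eta / 2) ^+ (r ^ 2).
  apply: le_trans (bernoulli_ge _ _); last by rewrite divr_ge0 // ltW.
  rewrite natrX -/x mulrA /eta mulfV ?expf_neq0 ?gt_eqF //; lra.
pose q : R := 3 / 2.
have q_gt0 : 0 < q by rewrite divr_gt0.
have qr : y ^+ 4 <= q ^+ r.
  rewrite -(@ler_pXn2r _ 2) ?nnegrE ?exprn_ge0 ?(ltW y_gt0) ?(ltW q_gt0) //.
  rewrite -exprM; apply: le_trans pow_ge _; rewrite -exprM mulnC exprM.
  by rewrite lerXn2r ?nnegrE ?exprn_ge0 ?(ltW q_gt0) // /q; lra.
have qN : q ^+ r.-1 <= (1 + eta / 2) ^+ N.-1.
  apply: (@le_trans _ _ ((1 + eta / 2) ^+ (r ^ 2 * r.-1))); last by rewrite ler_weXn2l.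
  rewrite exprM lerXn2r ?nnegrE ?(ltW q_gt0) // exprn_ge0 // (le_trans ler01) //.
apply: (@le_trans _ _ 2).
  rewrite (_ : 2 = 1 + 1) // lerD2l ler_pdivrMr ?exprn_gt0 // mul1r.
  apply: le_trans pow_ge; apply: (@le_trans _ _ y); first by rewrite y_def lerDl.
  by rewrite ler_eXnr // ler1n.
apply: (@le_trans _ _ (x / (4 * y ^+ 4) * q ^+ r.-1)); last first.
  by apply: ler_pM => //; rewrite ?divr_ge0 ?mulr_ge0 ?exprn_ge0 ?(ltW q_gt0) // ltW.
apply: (@le_trans _ _ (x / (4 * y ^+ 4) * (y ^+ 4 * (2 / 3)))).
  have -> : x / (4 * y ^+ 4) * (y ^+ 4 * (2 / 3)) = x / 6.
    by field; rewrite gt_eqF.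
  by move: x_ge; move: x => t; lra.
rewrite ler_wpM2l ?divr_ge0 ?mulr_ge0 ?exprn_ge0 //.
have -> : q ^+ r.-1 = q ^+ r * (2 / 3).
  rewrite -[in RHS](prednK r_gt0) exprSr -mulrA /q.
  by rewrite (_ : 3 / 2 * (2 / 3) = 1) ?mulr1 //; field.
by rewrite ler_wpM2r // divr_ge0.
Qed.

Lemma tree_profile_exists : tree_profile K.+1 d (fun=> 0%N).
Proof.
apply: (@tree_profile_growth R K d r N eta) => //.
- exact: leq_trans N_ge2.
- exact: ltnW.
- by move: eta_le; move: eta => t; lra.
- rewrite lef_pV2 ?posrE ?exprn_gt0 //; apply: le_trans pow_ge.
  rewrite y_def; apply: (@le_trans _ _ ((x + 1) ^+ 2)).
    by rewrite lerXn2r ?nnegrE ?addr_ge0 // lerDl.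
  by rewrite ler_weXn2l // lerDr.
Qed.

End Calibration.

(** * The threshold *)

Section Threshold.
Local Open Scope ring_scope.

Lemma forces_sat_le (k : nat) (d d' : int) : d' <= d -> forces_sat k d -> forces_sat k d'.
Proof. by move=> dd sd V F Fk Fd; apply: sd => // C /Fd /le_trans; apply. Qed.

(** A negative bound admits only the empty formula. *)
Lemma forces_satN1 (k : nat) : forces_sat k (- 1).
Proof.
move=> V F _ Fd; exists (fun=> true) => C /Fd.
by [].
Qed.

(** The complete tree of depth [k], or the empty clause for [k = 0], shows that the admissible
    bounds are bounded above. *)
Lemma not_forces_sat (k : nat) : exists n : nat, ~ forces_sat k n%:Z.
Proof.
case: k => [|k].
  exists 0%N => /(_ void [set finset.set0]%SET); case.
  - by move=> C; rewrite inE => /eqP ->; rewrite cards0.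
  - move=> C; rewrite inE => /eqP ->; rewrite lez_nat leqn0 cards_eq0.
    by apply/eqP/setP => D; rewrite !inE; case: eqP.
  - by move=> s /(_ finset.set0); rewrite inE eqxx => /(_ isT)[x]; rewrite inE.
exists (k.+1 * 2 ^ k)%N; apply: tree_profile_not_forces_sat => //.
have h := @tree_profile_complete k.+1 (2 ^ k) k (ltnSn k) (leqnn _).
apply: (tree_node _ _ _ h h) => [i ik||]; try exact: sum_single_profile.
by case: eqP => // E; move: ik; rewrite E ltnn.
Qed.

Lemma largest_forcing_exists (k : nat) : exists l : int, is_largest_forcing k l.
Proof.
have [n0 Hn0] := not_forces_sat k.
have ex : exists n : nat, `[< ~ forces_sat k n%:Z >] by exists n0; apply/asboolP.
case: (ex_minnP ex) => n /asboolP nn nmin; exists (n%:Z - 1); split.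
  case: n nn nmin => [|m] _ nmin; first exact: forces_satN1.
  rewrite -addn1 PoszD addrK; apply: contrapT => /asboolP /nmin.
  by rewrite ltnn.
move=> d' d'k; rewrite leNgt; apply/negP => h; apply: nn; apply: forces_sat_le d'k.
by move: h; clear; lia.
Qed.

(** The local lemma applies as long as [d + 1 <= 2 ^ k / e]. *)
Lemma forces_sat_floor (R : realType) (k : nat) :
  forces_sat k (Num.floor ((2 : R) ^+ k / expR 1) - 1).
Proof.
set X := 2 ^+ k / expR 1.
have X0 : 0 <= X by rewrite divr_ge0 ?expR_ge0 ?exprn_ge0.
have [n Xn] : exists n : nat, Num.floor X = n%:Z.
  by exists `|Num.floor X|%N; rewrite gez0_abs // floor_ge0.
rewrite Xn; case: n Xn => [|n] Xn; first exact: forces_satN1.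
rewrite -addn1 PoszD addrK => V F Fk Fd.
apply: (@local_lemma R k n) => //.
by rewrite mulrC -ler_pdivlMr ?expR_gt0 // pmulrn -Xn floor_le.
Qed.

Lemma fourth_root (K : nat) : exists r, (r ^ 4 <= K < r.+1 ^ 4)%N.
Proof.
elim: K => [|K [r /andP[rK Kr]]]; first by exists 0%N.
have [h|h] := ltnP K.+1 (r.+1 ^ 4); first by exists r; rewrite h leqW.
exists r.+1; rewrite h /=; apply: leq_ltn_trans Kr _.
by rewrite ltn_exp2r.
Qed.

(** The tree for the least [d] above [X] gives [l <= (K + 1) * d]. With [eta = r ^ -2], replacing
    [K] by [K + 1] and the surplus [10 * eta] cost [21 * eta], and rounding [d] costs one more
    [eta]. *)
Lemma forces_sat_upper (R : realType) (r K : nat) (l : int) :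
  (255 <= r)%N -> (r ^ 4 <= K < r.+1 ^ 4)%N -> forces_sat K.+1 l ->
  l%:~R / (2 : R) ^+ K.+1 - (expR 1)^-1 <= 22 / r%:R ^+ 2.
Proof.
move=> r_ge /andP[K_ge K_lt] sat_l.
pose x : R := r%:R; pose L : R := K%:R; pose eta := (x ^+ 2)^-1.
have x_ge : 255 <= x by rewrite ler_nat.
have x_gt0 : 0 < x by apply: lt_le_trans x_ge.
have L_ge : x ^+ 4 <= L by rewrite -natrX ler_nat.
have x24 : x ^+ 2 <= L.
  by apply: le_trans L_ge; rewrite ler_weXn2l // (le_trans _ x_ge) // ler1n.
have L_gt0 : 0 < L by apply: lt_le_trans x24; rewrite exprn_gt0.
pose X := 2 / expR 1 * (1 + 10 / x ^+ 2) * (2 ^+ K / L).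
pose d := (Num.truncn X).+1.
have X_ge0 : 0 <= X.
  by rewrite !mulr_ge0 ?invr_ge0 ?expR_ge0 ?addr_ge0 ?divr_ge0 ?exprn_ge0 // ltW.
have Xd : X <= d%:R by apply: ltW; apply: truncnS_gt.
have dX : d%:R <= X + 1 by rewrite /d -natr1 lerD2r truncn_le.
have tree := tree_profile_exists r_ge K_ge K_lt Xd.
have ld : l <= (K.+1 * d)%:Z.
  rewrite leNgt; apply/negP => h; apply: (tree_profile_not_forces_sat _ tree) => //.
  by apply: forces_sat_le sat_l; apply: ltW.
have lX : l%:~R <= (L + 1) * (X + 1).
  apply: (@le_trans _ _ (K.+1 * d)%:R); first by rewrite pmulrn ler_int.
  by rewrite natrM -natr1 ler_wpM2l // addr_ge0 // ltW.
have eta_gt0 : 0 < eta by rewrite invr_gt0 exprn_gt0.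
have eta_le1 : eta <= 1.
  by rewrite invf_le1 ?exprn_gt0 // exprn_ege1 // (le_trans _ x_ge) // ler1n.
have L_eta : L^-1 <= eta by rewrite lef_pV2 ?posrE ?exprn_gt0.
have k_eta : (L + 1) / 2 ^+ K.+1 <= eta.
  have K255 : (255 <= K)%N.
    apply: (leq_trans r_ge); apply: leq_trans K_ge.
    by rewrite (expnS r 3) leq_pmulr // expn_gt0 (leq_trans _ r_ge).
  apply: le_trans L_eta; rewrite ler_pdivrMr ?exprn_gt0 // ler_pdivlMl //.
  apply: (@le_trans _ _ (K.+1 ^ 8)%:R); last first.
    by rewrite -natrX ler_nat (leq_trans (expr2_ge_expS8 K255)) // leq_exp2l.
  have -> : L + 1 = K.+1%:R by rewrite -natr1.
  rewrite -natrM ler_nat; apply: (@leq_trans (K.+1 ^ 2)%N).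
    by rewrite -mulnn leq_mul2r leqnSn orbT.
  by rewrite leq_pexp2l.
have E_le1 : (expR 1)^-1 <= 1 :> R.
  by rewrite invf_le1 ?expR_gt0 // -[leLHS]expR0 ler_expR.
have E_ge0 : 0 <= (expR 1)^-1 :> R by rewrite invr_ge0 expR_ge0.
apply: (@le_trans _ _ ((expR 1)^-1 * ((1 + L^-1) * (1 + 10 * eta)) +
    (L + 1) / 2 ^+ K.+1 - (expR 1)^-1)).
  rewrite lerD2r ler_pdivrMr ?exprn_gt0 //; apply: le_trans lX _.
  rewrite le_eqVlt; apply/orP; left; apply/eqP; rewrite /X -/eta exprS.
  by field; rewrite !gt_eqF ?expR_gt0 ?exprn_gt0.
have -> : 22 / r%:R ^+ 2 = 22 * eta by [].
clearbody eta.
have : (1 + L^-1) * (1 + 10 * eta) <= 1 + 21 * eta.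
  have Li : 0 <= L^-1 by rewrite invr_ge0 ltW.
  move: eta_gt0 eta_le1 L_eta Li; move: (L^-1) => a; clear; nra.
move: k_eta E_le1 E_ge0; move: (_ / 2 ^+ _) => a; move: (expR 1)^-1 => E.
move: ((1 + L^-1) * _) => b; move: eta_gt0; clear; nra.
Qed.

End Threshold.

Local Open Scope classical_set_scope.

Theorem theorem2 (R : realType) :
  exists l : nat -> int,
    (forall k : nat, is_largest_forcing k (l k)) /\
    (forall k : nat, Num.floor ((2 : R) ^+ k / expR 1) - 1 <= l k) /\
    exists eps : nat -> R,
      (forall k : nat,
         (l k)%:~R = ((expR 1)^-1 + eps k) * (2 : R) ^+ k) /\
      eps =O_\oo (fun k : nat => (k%:R : R) `^ (- (1 / 2))).
Proof.
have [l l_largest] := choice largest_forcing_exists.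
have l_lower k : Num.floor ((2 : R) ^+ k / expR 1) - 1 <= l k.
  by case: (l_largest k) => _; apply; apply: forces_sat_floor.
exists l; split=> //; split=> //.
exists (fun k => (l k)%:~R / 2 ^+ k - (expR 1)^-1); split.
  by move=> k; rewrite addrC subrK divfK // expf_neq0.
(* [88 = 22 * 4], because [k <= (r + 1) ^ 4 <= (2 * r) ^ 4] gives [r ^ -2 <= 4 / sqrt k]. *)
apply/eqO_exP; exists 88 => //.
near=> k.
have k_large : (255 ^ 4 < k)%N by near: k; exact: nbhs_infty_gt.
have k_gt0 : (0 < k)%N by apply: leq_ltn_trans k_large.
rewrite mul1r powRN powR12_sqrt // [X in _ <= _ * X]ger0_norm ?invr_ge0 ?sqrtr_ge0 //.
have sk_gt0 : 0 < Num.sqrt k%:R :> R by rewrite sqrtr_gt0 ltr0n.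
rewrite ler_norml; apply/andP; split.
  (* The floor and the subtracted one lose at most [2], which is negligible against
     [2 ^ k / sqrt k]. *)
  have h : 2 ^+ k / expR 1 - 2 <= (l k)%:~R :> R.
    apply: (@le_trans _ _ (Num.floor ((2 : R) ^+ k / expR 1) - 1)%:~R);
      last by rewrite ler_int.
    have := ltW (floorD1_gt ((2 : R) ^+ k / expR 1)).
    rewrite intrD intrB mulr1z => h; rewrite lerBlDr -addrA (_ : - 1 + 2 = 1) //.
    by ring.
  apply: (@le_trans _ _ (- (2 / 2 ^+ k))).
    rewrite lerN2 ler_pM ?invr_ge0 ?exprn_ge0 //; first by rewrite ler_nat.
    rewrite lef_pV2 ?posrE ?exprn_gt0 //; apply: (@le_trans _ _ k%:R).
      rewrite -[leRHS]sqr_sqrtr // expr2 ler_peMr // ?(ltW sk_gt0) //.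
      by rewrite -[leLHS]sqrtr1 ler_wsqrtr // ler1n.
    by rewrite -natrX ler_nat ltnW // ltn_expl.
  have k2 : 0 < 2 ^+ k :> R by rewrite exprn_gt0.
  rewrite lerBrDr addrC -(ler_pM2r k2) divfK ?gt_eqF // mulrBl divfK ?gt_eqF //.
  by rewrite mulrC.
have [K kE] : exists K, k = K.+1 by exists k.-1; rewrite prednK.
rewrite kE in k_large sk_gt0 *.
have [r rK] := fourth_root K; have /andP[rK1 rK2] := rK.
have r_ge : (255 <= r)%N.
  rewrite leqNgt; apply/negP => r_lt.
  have : (K < 255 ^ 4)%N by apply: leq_trans rK2 _; rewrite leq_exp2r.
  by rewrite ltnNge -ltnS k_large.
have r_gt0 : 0 < r%:R :> R by rewrite ltr0n (leq_trans _ r_ge).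
case: (l_largest K.+1) => sat _.
apply: le_trans (forces_sat_upper R r_ge rK sat) _.
have -> : 88 = 22 * 4 :> R by rewrite -natrM.
rewrite -mulrA ler_pM2l // ler_pdivlMr // mulrC ler_pdivrMr ?exprn_gt0 //.
have -> : 4 * r%:R ^+ 2 = Num.sqrt ((4 * r%:R ^+ 2) ^+ 2) :> R.
  by rewrite sqrtr_sqr ger0_norm // mulr_ge0 // exprn_ge0 // ltW.
apply: ler_wsqrtr.
have -> : (4 * r%:R ^+ 2) ^+ 2 = ((2 * r) ^ 4)%:R :> R by rewrite natrX natrM; ring.
rewrite ler_nat; apply: leq_trans rK2 _.
rewrite leq_exp2r //; move: r_ge; clear; lia.
Unshelve. all: by end_near.
Qed.
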